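(* Let $H$ be a real separable Hilbert space with orthonormal basis $(e_n)_{n\ge 1}$, let $A$ be the infinitesimal generator of a $C_0$-semigroup $(S(t))_{t\ge 0}$ on $H$, and let $L(t)=\sum_{n=1}^\infty \beta_n L^n(t)e_n$, $t\ge 0$, where $(\beta_n)$ is a sequence of positive numbers and $L^n$, $n\ge 1$, are independent, identically distributed, càdlàg, real-valued Lévy processes whose common jump intensity (Lévy) measure $\nu$ is not identically $0$. Assume that the process $$X(t)=\int_0^t S(t-s)\,dL(s),\qquad t\ge 0,$$ i.e. the weak solution of $dX(t)=AX(t)\,dt+dL(t)$, $X(0)=0$, is an $H$-valued process, and that $e_n\in D(A^* )$ for every $n$, where $A^*$ is the adjoint of $A$. If $\beta_n$ does not converge to $0$ as $n\to\infty$, then, with probability $1$, the trajectory of $X$ has no point $t\in[0,+\infty)$ at which there exists the left limit $X(t-)\in H$ or the right limit $X(t+)\in H$.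
   Context: The series defining $L$ need not converge in $H$; it is understood as converging in a possibly larger Hilbert space $U\supset H$, and the integral defining $X$ is the stochastic convolution $\sum_n \beta_n\int_0^t S(t-s)e_n\,dL^n(s)$. That $X$ is an $H$-valued weak solution means in particular that $X$ is a measurable $H$-valued process such that, for every $n$, $s\mapsto\langle X(s),A^*e_n\rangle_H$ is almost surely locally integrable and, for every $t\ge 0$, almost surely $$\langle X(t),e_n\rangle_H=\int_0^t\langle X(s),A^*e_n\rangle_H\,ds+\beta_nL^n(t).$$ Limits $X(t\pm)$ are taken in the norm of $H$; left limits are considered only at $t>0$ and right limits at $t\ge 0$. ''With probability $1$'' means outside a set contained in an event of probability zero. *)

(* Defs.v *)
From HB Require Import structures.
From mathcomp Require Import all_boot all_order all_algebra.
From mathcomp Require Import all_classical all_reals all_analysis.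

Set Implicit Arguments.
Unset Strict Implicit.
Unset Printing Implicit Defensive.

Import Order.TTheory GRing.Theory Num.Theory.
Import numFieldNormedType.Exports.

Local Open Scope classical_set_scope.
Local Open Scope ring_scope.

(* Conventions: time is [R], and only times [0 <= t] are ever constrained;
   families indexed by [n >= 1] are indexed here by all of [nat]. *)

Section HilbertSpace.
Context {R : realType} {H : completeNormedModType R}.
Implicit Types ip : {dot H for idfun}.

(* A complete normed space with such an [ip] is a real Hilbert space. *)
Definition induces_norm ip := forall x : H, ip x x = `|x| ^+ 2.

Definition separable_space := exists2 D : set H, countable D & dense D.

Definition orthonormal_basis ip (e : nat -> H) :=
  (forall m n, ip (e m) (e n) = (m == n)%:R) /\
  (forall x, series (fun n => ip x (e n) *: e n) @ \oo --> x).

Definition C0_semigroup (S : R -> H -> H) :=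
  [/\ forall t, 0 <= t -> linear (S t) /\ continuous (S t),
      S 0 = id,
      forall s t, 0 <= s -> 0 <= t -> S (s + t) = S s \o S t
    & forall x, S t x @[t --> 0^'+] --> x].

(* The value of [op_fun] outside [op_dom] is irrelevant. *)
Record partial_operator := PartialOperator {
  op_dom : set H ;
  op_fun :> H -> H }.

Definition is_generator (S : R -> H -> H) (A : partial_operator) :=
  (forall x, op_dom A x <->
     exists y : H, h^-1 *: (S h x - x) @[h --> 0^'+] --> y) /\
  (forall x, op_dom A x -> h^-1 *: (S h x - x) @[h --> 0^'+] --> A x).

(* This determines [As] on its domain when [op_dom A] is dense, as is the
   domain of the generator of a C_0-semigroup. *)
Definition is_adjoint ip (A As : partial_operator) :=
  (forall y, op_dom As y <->
     exists z, forall x, op_dom A x -> ip (A x) y = ip x z) /\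
  (forall x y, op_dom A x -> op_dom As y -> ip (A x) y = ip x (As y)).

End HilbertSpace.

Arguments separable_space {R} H.
Arguments partial_operator {R} H.

Section Independence.
Context {d : measure_display} {T : measurableType d} {R : realType}.
Variable P : probability T R.

Definition mutually_independent {I : eqType} (F : I -> set (set T)) :=
  forall (J : seq I) (E : I -> set T), uniq J ->
    (forall i, i \in J -> F i (E i)) ->
    P (\bigcap_(i in [set` J]) E i) = (\prod_(i <- J) P (E i))%E.

Definition sigma_rv (Y : T -> R) : set (set T) :=
  preimage_set_system setT Y measurable.

(* The product sigma-algebra of R^[0, oo), on paths indexed by all of [R]. *)
Definition path_measurable : set (set (R -> R)) :=
  <<s [set C | exists t (B : set R),
        [/\ 0 <= t, measurable B & C = [set f | B (f t)]]] >>.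

Definition trajectory (Z : R -> T -> R) (w : T) : R -> R := fun t => Z t w.

Definition sigma_process (Z : R -> T -> R) : set (set T) :=
  preimage_set_system setT (trajectory Z) path_measurable.

Definition same_law (Y Z : R -> T -> R) :=
  forall C, path_measurable C -> P (trajectory Y @^-1` C) = P (trajectory Z @^-1` C).

End Independence.

Section LevyProcess.
Context {d : measure_display} {T : measurableType d} {R : realType}.
Variable P : probability T R.

Definition cadlag (f : R -> R) :=
  (forall t, 0 <= t -> f s @[s --> t^'+] --> f t) /\
  (forall t, 0 < t -> exists l : R, f s @[s --> t^'-] --> l).

(* Continuity in probability is not listed: it follows from cadlag paths and
   stationarity of the increments. *)
Definition cadlag_Levy_process (Z : R -> T -> R) :=
  [/\ forall t, 0 <= t -> measurable_fun setT (Z t),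
      {ae P, forall w, Z 0 w = 0},
      forall t : nat -> R, 0 <= t 0%N -> nondecreasing_seq t ->
        mutually_independent P (fun i => sigma_rv (Z (t i.+1) \- Z (t i))),
      forall s t (B : set R), 0 <= s -> 0 <= t -> measurable B ->
        P ((Z (s + t) \- Z s) @^-1` B) = P ((Z t \- Z 0) @^-1` B)
    & {ae P, forall w, cadlag (trajectory Z w)}].

Definition jump (f : R -> R) (t : R) : R := f t - lim (f s @[s --> t^'-]).

(* nu B is the expected number of jumps with (nonzero) size in B during
   ]0, 1]. *)
Definition is_Levy_measure (Z : R -> T -> R) (nu : set R -> \bar R) :=
  forall B : set R, measurable B ->
    nu B = (\int[P]_w counting [set s : R | [/\ (0 < s <= 1)%R,
      jump (trajectory Z w) s != 0%R & B (jump (trajectory Z w) s)]])%E.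

End LevyProcess.

Section OrnsteinUhlenbeck.
Context {d : measure_display} {T : measurableType d} {R : realType}.
Variable P : probability T R.
Context {H : completeNormedModType R}.

Definition borel := g_sigma_algebraType (@open H).

Definition riemann_sum (f : R -> H) (Z : R -> R) (s : seq R) : H :=
  \sum_(i < size s) (Z s`_i - Z (0 :: s)`_i) *: f (0 :: s)`_i.

(* Integral over [0, t] of a deterministic continuous integrand: the limit in
   probability of the Riemann sums as the mesh of the partition tends to 0. *)
Definition is_stochastic_integral (f : R -> H) (Z : R -> T -> R) (t : R)
    (Y : T -> H) :=
  measurable_fun setT (Y : T -> borel) /\
  forall eps : R, 0 < eps -> exists2 delta : R, 0 < delta &
    forall s : seq R, itv_partition 0 t s ->
      (forall i : 'I_(size s), s`_i - (0 :: s)`_i < delta) ->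
      (P [set w | (eps < `|Y w - riemann_sum f (trajectory Z w) s|)%R] <= eps%:E)%E.

(* [j] embeds [H] in the larger space [U]; the terms of the series below are
   independent, so that almost sure convergence is the same as convergence in
   probability. *)
Definition is_stochastic_convolution {U : completeNormedModType R}
    (j : H -> U) (S : R -> H -> H) (beta : nat -> R) (e : nat -> H)
    (L : nat -> R -> T -> R) (X : R -> T -> H) :=
  exists I : nat -> R -> T -> H,
    (forall n t, 0 <= t ->
       is_stochastic_integral (fun s => S (t - s) (e n)) (L n) t (I n t)) /\
    (forall t, 0 <= t ->
       {ae P, forall w,
          series (fun n => j (beta n *: I n t w)) @ \oo --> j (X t w)}).

Definition is_cylindrical_sum {U : completeNormedModType R}
    (j : H -> U) (beta : nat -> R) (e : nat -> H)
    (L : nat -> R -> T -> R) (Lsum : R -> T -> U) :=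
  forall t, 0 <= t ->
    {ae P, forall w,
       series (fun n => j ((beta n * L n t w) *: e n)) @ \oo --> Lsum t w}.

Definition measurable_process (X : R -> T -> H) :=
  measurable_fun ([set t : R | 0 <= t] `*` [set: T])
    (fun p : measurableTypeR R * T => X p.1 p.2 : borel).

(* The weak formulation of dX = AX dt + dL, X(0) = 0, tested against the basis
   vectors. *)
Definition weak_solution (ip : {dot H for idfun}) (As : partial_operator H)
    (beta : nat -> R) (e : nat -> H) (L : nat -> R -> T -> R)
    (X : R -> T -> H) :=
  [/\ measurable_process X,
      forall n, {ae P, forall w, forall t, 0 <= t ->
        lebesgue_measure.-integrable `[0, t]
          (EFin \o (fun s => ip (X s w) (As (e n))))}
    & forall n t, 0 <= t -> {ae P, forall w,
        ip (X t w) (e n) =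
          \int[lebesgue_measure]_(s in `[0, t]) ip (X s w) (As (e n))
          + beta n * L n t w}].

End OrnsteinUhlenbeck.

(* Main.v *)
(** By the weak formulation, at rational times each coordinate <X, e_n> is a
    continuous function plus beta_n L^n.  Choose c > 0 with beta_n >= c for
    infinitely many n.  Since nu is not 0, there is a > 0 such that on every
    rational interval L^n has a jump of size at least a with a positive
    probability independent of n; by independence, almost surely on every
    rational interval this happens for some n with beta_n >= c.  So X
    oscillates by at least c a / 2 on every interval, and has no one-sided
    limit.

    Jumps are replaced by increments exceeding a on arbitrarily fine
    equidistant grids: these events depend on countably many times, and
    their probabilities follow from stationarity and independence of the
    increments alone. *)

Require Import Defs.
From HB Require Import structures.
From mathcomp Require Import all_boot all_order all_algebra.
From mathcomp Require Import all_classical all_reals all_analysis.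
From mathcomp Require Import ring lra zify.

Set Implicit Arguments.
Unset Strict Implicit.
Unset Printing Implicit Defensive.

Import Order.TTheory GRing.Theory Num.Theory.
Import numFieldNormedType.Exports.

Local Open Scope classical_set_scope.
Local Open Scope ring_scope.

Import HBNNSimple.

(* [f] need not be measurable: in the definition of the Levy measure the
   number of jumps is not known to be so. *)
Lemma ae_eq0_integral (R : realType) (d : measure_display)
    (T : measurableType d) (mu : {measure set T -> \bar R}) (f : T -> \bar R) :
  (forall x, (0 <= f x)%E) -> {ae mu, forall x, f x = 0%E} ->
  (\int[mu]_x f x = 0)%E.
Proof.
move=> f0 [N [mN muN fN]]; rewrite ge0_integralTE//.
apply/eqP; rewrite eq_le; apply/andP; split; last first.
  by apply: ereal_sup_ubound; exists nnsfun0 => //; exact: sintegral0.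
apply/ge_ereal_sup => _ [h /= hf <-].
rewrite /sintegral fsbig1// => r _.
have [->|r0] := eqVneq r 0; first by rewrite mul0e.
(* A simple [h] below [f] takes a nonzero value only where [f] is nonzero, hence inside the null set
   [N]. *)
suff -> : mu (h @^-1` [set r]) = 0%E by rewrite mule0.
apply: (subset_measure0 _ mN _ muN) => // x /= hx; apply: fN => /= fx0.
have := hf x; rewrite fx0 hx lee_fin => rle0.
have : 0 <= h x by [].
by rewrite hx => rge0; case/eqP: r0; lra.
Qed.

(** Expand the squared norm of [x - ip x u *: u], which is nonnegative. *)
Lemma dot_le_norm (R : realType) (H : completeNormedModType R)
    (ip : {dot H for idfun}) (x u : H) :
  induces_norm ip -> ip u u = 1 -> `|ip x u| <= `|x|.
Proof.
move=> ipN u1.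
have Hs a b : ip a b = ip b a.
  by have := @hermC _ _ _ _ ip a b; rewrite /= expr0 mul1r.
have := sqr_ge0 `|x - ip x u *: u|.
rewrite -ipN linearBl linearBr /= linearBr/= !linearZl_LR /= !linearZr_LR/=.
rewrite u1 (Hs u x) ipN /GRing.scale/= mulr1 subrr subr0 subr_ge0 -expr2 => h.
by rewrite -(@ler_pXn2r _ 2)// ?nnegrE// real_normK ?num_real.
Qed.

(** * Large increments on equidistant grids *)

Definition cell_jump (R : realType) (a : R) (M i : nat) : set (R -> R) :=
  [set f | a < `|f (i.+1%:R / M%:R) - f (i%:R / M%:R)|].

Definition block_jump (R : realType) (a : R) (M b N : nat) : set (R -> R) :=
  \bigcup_(i in [set i | (b <= i < b + N)%N]) cell_jump a M i.

(* Increments exceeding [a] occur in [[i / (k + 1), (i + 1) / (k + 1)]] on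
   infinitely many of the grids of mesh [1 / ((k + 1) (m + 1))]; these meshes
   make the interval a union of exactly [m + 1] cells and [[0, 1]] a union of
   [k + 1] such blocks. *)
Definition rough (R : realType) (a : R) (k i : nat) : set (R -> R) :=
  lim_sup_set (fun m => block_jump a (k.+1 * m.+1) (i * m.+1) m.+1).

Section PathMeasurability.
Context (R : realType).

(** The sigma-algebra [path_measurable] packaged as a measurable type. *)
Definition path_space := g_sigma_algebraType
  [set C : set (R -> R) | exists t (B : set R),
    [/\ 0 <= t, measurable B & C = [set f | B (f t)]]].

Lemma measurable_coord (t : R) : 0 <= t ->
  measurable_fun setT ((fun f => f t) : path_space -> R).
Proof.
move=> t0 _ B mB; rewrite setTI; apply: sub_sigma_algebra.
by exists t, B; split.
Qed.

Lemma measurable_cell_jump a M i :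
  measurable (cell_jump a M i : set path_space).
Proof.
have ge0 j : 0 <= j%:R / M%:R :> R by rewrite divr_ge0.
have mf : measurable_fun setT (fun f : path_space =>
    `|f (i.+1%:R / M%:R) - f (i%:R / M%:R)|).
  apply: measurableT_comp => //.
  by apply: measurable_realfun.measurable_funB; exact: measurable_coord.
have := mf measurableT `]a, +oo[%classic (measurable_itv _).
rewrite setTI; congr measurable; apply/seteqP.
by split => f /=; rewrite in_itv/= andbT.
Qed.

Lemma measurable_block_jump a M b N :
  measurable (block_jump a M b N : set path_space).
Proof. by apply: bigcup_measurable => i _; exact: measurable_cell_jump. Qed.

Lemma measurable_rough a k i : measurable (rough a k i : set path_space).
Proof.
apply: bigcap_measurable; first by exists 0%N.
move=> n _; apply: bigcup_measurable => m _; exact: measurable_block_jump.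
Qed.

Lemma measurable_trajectory (d : measure_display) (T : measurableType d)
    (Z : R -> T -> R) :
  (forall t, 0 <= t -> measurable_fun setT (Z t)) ->
  measurable_fun setT (trajectory Z : T -> path_space).
Proof.
move=> mZ; apply: measurability => // _ [_ [t [B [t0 mB ->]]] <-].
exact: mZ.
Qed.

End PathMeasurability.

(** * Grid events of one Lévy process *)

(** The increments over the [N] cells are independent and, by stationarity, distributed as the one
    over cell 0. *)
Lemma levy_avoid_block (R : realType) (d : measure_display)
    (T : measurableType d) (P : probability T R) (Z : R -> T -> R)
    (a : R) (M b N : nat) :
  cadlag_Levy_process P Z ->
  P (trajectory Z @^-1` (~` block_jump a M b N)) =
  (fine (P (trajectory Z @^-1` (~` cell_jump a M 0))) ^+ N)%:E.
Proof.
move=> [mZ _ indep stat _].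
pose t i : R := i%:R / M%:R.
have t_ge0 i : 0 <= t i by rewrite divr_ge0.
have t_nd : nondecreasing_seq t.
  by move=> i j ij; rewrite /t ler_wpM2r ?invr_ge0// ler_nat.
pose B : set R := [set x | `|x| <= a].
have mB : measurable B.
  have -> : B = `[- a, a]%classic.
    by apply/seteqP; split => x; rewrite /B/= in_itv/= ler_norml.
  exact: measurable_itv.
pose E i : set T := (Z (t i.+1) \- Z (t i)) @^-1` B.
have cellE i : trajectory Z @^-1` (~` cell_jump a M i) = E i.
  by apply/seteqP; split => w; rewrite /E/B/cell_jump/= leNgt => /negP.
have PE i : P (E i) = P (trajectory Z @^-1` (~` cell_jump a M 0)).
  rewrite cellE /E.
  have -> : t i.+1 = t i + t 1%N by rewrite /t -mulrDl natr1.
  have t00 : t 0%N = 0 by rewrite /t mul0r.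
  by rewrite [LHS]stat// t00.
have -> : trajectory Z @^-1` (~` block_jump a M b N) =
    \bigcap_(i in [set` iota b N]) E i.
  apply/seteqP; split => w /= h.
    by move=> i /=; rewrite mem_iota => bi; rewrite -cellE => ci; apply: h; exists i.
  case=> i /= bi ci; have := h i; rewrite /= mem_iota => /(_ bi).
  by rewrite -cellE; apply.
rewrite (indep t (t_ge0 0%N) t_nd (iota b N) E) ?iota_uniq//; last first.
  by move=> i _; exists B => //; rewrite setTI.
rewrite (eq_bigr (fun=> (fine (P (trajectory Z @^-1` (~` cell_jump a M 0))))%:E)).
  by rewrite prodEFin big_const_seq count_predT size_iota iter_mulr_1.
move=> i _; rewrite PE fineK// fin_num_measure//.
rewrite cellE -[X in measurable X]setTI.
by apply: measurable_realfun.measurable_funB => //; exact: mZ.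
Qed.

(** On a fine grid, the cell []u, v]] containing [t] has [f v] close to [f t] and [f u] close to the
    left limit, so its increment is close to the jump. Thresholds [1 / (k + 1)] keep the family of
    events countable. *)
Lemma cadlag_jump_cells (R : realType) (f : R -> R) (t : R) :
  cadlag f -> 0 < t <= 1 -> jump f t != 0 ->
  exists k M0, forall M, (M0 <= M)%N -> block_jump k.+1%:R^-1 M 0 M f.
Proof.
move=> [rc ll] /andP[t0 t1] J0.
have [l fl] := ll t t0.
have Jl : jump f t = f t - l by rewrite /jump; congr (_ - _); exact: cvg_lim.
(* Two errors below [a] leave an increment above [3 a - 2 a = a]. *)
pose a := `|jump f t| / 3.
have a0 : 0 < a by rewrite divr_gt0// normr_gt0.
have [k ka] : exists k, k.+1%:R^-1 < a.
  by exists (Num.trunc a^-1); rewrite invf_plt ?posrE//; exact: truncnS_gt.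
have /cvgrPdist_lt /(_ a a0) [d1 /= d10 h1] := rc t (ltW t0).
have /cvgrPdist_lt /(_ a a0) [d2 /= d20 h2] := fl.
pose d := Num.min d1 d2.
have d0 : 0 < d by rewrite lt_min d10.
exists k, (Num.trunc d^-1).+1 => M M0.
have dM : d^-1 < M%:R.
  by rewrite (lt_le_trans (truncnS_gt _))// ler_nat.
have M_gt0 : 0 < M%:R :> R by rewrite (lt_trans _ dM)// invr_gt0.
have Md : M%:R^-1 < d by rewrite invf_plt ?posrE.
have exM : t <= M%:R / M%:R by rewrite divff// gt_eqF.
(* The right end of the cell is the first grid point not before [t]; it is not 0 because [0 < t]. *)
have [[|i] hi imin] := ex_minnP (ex_intro (fun j => t <= j%:R / M%:R) M exM).
  by move: hi; rewrite mul0r leNgt t0.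
have it : i%:R / M%:R < t.
  by rewrite ltNge; apply/negP => /imin; rewrite ltnn.
have step : i.+1%:R / M%:R = i%:R / M%:R + M%:R^-1 :> R.
  by rewrite -natr1 mulrDl mul1r.
exists i; first by rewrite /= add0n; exact: imin.
rewrite /cell_jump/=.
set v := i.+1%:R / M%:R in hi step *; set u := i%:R / M%:R in it step *.
have dd : d <= d1 /\ d <= d2 by split; rewrite ge_min lexx ?orbT.
have F1 : `|f t - f v| < a.
  move: hi; rewrite le_eqVlt => /predU1P[<-|tv]; first by rewrite subrr normr0.
  by apply: h1 => //; rewrite /ball/= ltr0_norm; lra.
have F2 : `|l - f u| < a.
  by apply: h2 => //; rewrite /ball/= gtr0_norm; lra.
have : `|f t - l| <= `|f t - f v| + `|f v - f u| + `|l - f u|.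
  rewrite (_ : f t - l = (f t - f v) + (f v - f u) + (f u - l)); last by ring.
  by rewrite (distrC l); apply: le_trans (ler_normD _ _) _; rewrite lerD2r ler_normD.
have : `|f t - l| = 3 * a by rewrite /a Jl; field.
move=> J3 J4; apply: lt_trans ka _; clearbody a; lra.
Qed.

(** If every event [F k M0] below were null, almost no path would jump in []0, 1]], and [nu] would
    vanish. *)
Lemma levy_jump_cells (R : realType) (d : measure_display)
    (T : measurableType d) (P : probability T R) (Z : R -> T -> R)
    (nu : set R -> \bar R) :
  cadlag_Levy_process P Z -> is_Levy_measure P Z nu ->
  (exists2 B : set R, measurable B & nu B != 0%E) ->
  exists (a eta : R) (M0 : nat), [/\ 0 < a, 0 < eta &
    forall M, (M0 <= M)%N ->
      (eta%:E <= P (trajectory Z @^-1` block_jump a M 0 M))%E].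
Proof.
move=> [mZ _ _ _ cad] nuE [B mB /eqP nuB].
pose G k M := trajectory Z @^-1` block_jump k.+1%:R^-1 M 0 M.
have mG k M : measurable (G k M).
  rewrite -[G k M]setTI; apply: (measurable_trajectory mZ) => //.
  exact: measurable_block_jump.
pose F k M0 := \bigcap_(M in [set M | (M0 <= M)%N]) G k M.
have mF k M0 : measurable (F k M0).
  by apply: bigcap_measurable => //; exists M0 => /=.
have [[k [M0 PF]]|noF] := pselect (exists k M0, P (F k M0) <> 0%E).
  have Pfin : P (F k M0) \is a fin_num by exact: fin_num_measure.
  exists k.+1%:R^-1, (fine (P (F k M0))), M0; split => //.
    by rewrite fine_gt0// lt0e measure_ge0 andbT; apply/andP; split;
      [exact/eqP|rewrite ltey_eq Pfin].
  move=> M M0M; rewrite fineK//; apply: le_measure; rewrite ?inE//.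
    exact: mG.
  by move=> w /(_ M M0M).
exfalso; apply: nuB; rewrite nuE//; apply: ae_eq0_integral => [w|].
  exact: measure_ge0.
have aeF : {ae P, forall w, forall k M0, ~ F k M0 w}.
  apply/ae_foralln => k; apply/ae_foralln => M0; exists (F k M0); split => //.
    by apply: contrapT => PF; apply: noF; exists k, M0.
  by move=> w /= /contrapT.
apply: filterS2 cad aeF => w cadw nFw.
rewrite (_ : [set s : R | _] = set0) ?measure0//.
apply/seteqP; split => // s [s01 Js _].
have [k [M0 h]] := cadlag_jump_cells cadw s01 Js.
exact: (nFw k M0).
Qed.

(** This plays the part of a union bound over [K] blocks, [x] being the probability that one block
    has no large increment. *)
Lemma one_sub_expr_le (R : realDomainType) (x : R) (K : nat) :
  0 <= x <= 1 -> 1 - x ^+ K <= K%:R * (1 - x).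
Proof.
move=> /andP[x0 x1]; elim: K => [|K IH]; first by rewrite expr0 subrr mul0r.
have : x ^+ K * (1 - x) <= 1 * (1 - x).
  by rewrite ler_wpM2r ?subr_ge0// exprn_ile1.
rewrite exprSr -natr1; lra.
Qed.

(** For large [m] the grid event on one block has probability at least [eta / (k + 1)], and this
    bound passes to the upper limit of the events. *)
Lemma levy_rough_gt0 (R : realType) (d : measure_display)
    (T : measurableType d) (P : probability T R) (Z : R -> T -> R)
    (nu : set R -> \bar R) :
  cadlag_Levy_process P Z -> is_Levy_measure P Z nu ->
  (exists2 B : set R, measurable B & nu B != 0%E) ->
  exists2 a : R, 0 < a &
    forall k i, (0 < P (trajectory Z @^-1` rough a k i))%E.
Proof.
move=> levy nuE nuB.
have [a [eta [M0 [a0 eta0 block_ge]]]] := levy_jump_cells levy nuE nuB.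
have [mZ _ _ _ _] := levy.
exists a => // k i.
have mG M b N : measurable (trajectory Z @^-1` block_jump a M b N).
  rewrite -[X in measurable X]setTI; apply: (measurable_trajectory mZ) => //.
  exact: measurable_block_jump.
pose r M := fine (P (trajectory Z @^-1` (~` cell_jump a M 0))).
have r01 M : 0 <= r M <= 1.
  rewrite fine_ge0//= -lee_fin fineK ?probability_le1//.
    rewrite -[X in measurable X]setTI; apply: (measurable_trajectory mZ) => //.
    by apply: measurableC; exact: measurable_cell_jump.
  rewrite fin_num_measure//.
  rewrite -[X in measurable X]setTI; apply: (measurable_trajectory mZ) => //.
  by apply: measurableC; exact: measurable_cell_jump.
have PG M b N :
    P (trajectory Z @^-1` block_jump a M b N) = (1 - r M ^+ N)%:E.
  rewrite -[X in P X]setCK probability_setC; last exact: measurableC.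
  by rewrite [X in (_ - X)%E](levy_avoid_block a M b N levy).
pose F m := trajectory Z @^-1` block_jump a (k.+1 * m.+1) (i * m.+1) m.+1.
(* [[0, 1]] splits into [k + 1] equally likely blocks of [m + 1] cells. *)
have PF m : (M0 <= m)%N -> ((eta / k.+1%:R)%:E <= P (F m))%E.
  move=> M0m; have := block_ge (k.+1 * m.+1)%N.
  rewrite !PG !lee_fin mulnC exprM => h.
  rewrite ler_pdivrMr// mulrC; apply: le_trans (h _) _.
    by rewrite mulnS; lia.
  apply: one_sub_expr_le; have /andP[? ?] := r01 (m.+1 * k.+1)%N.
  by rewrite exprn_ge0//= exprn_ile1.
apply: (@lt_le_trans _ _ (eta / k.+1%:R)%:E); first by rewrite lte_fin divr_gt0.
have mF m : measurable (F m) by exact: mG.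
have mUF n : measurable (\bigcup_(m in [set m | (n <= m)%N]) F m).
  by apply: bigcup_measurable => m _; exact: mF.
(* Continuity from above along the decreasing tail unions. *)
have cvF : P (\bigcup_(m in [set m | (n <= m)%N]) F m) @[n --> \oo] -->
    P (lim_sup_set F).
  apply: lim_sup_set_cvg => //.
  by rewrite ltey_eq; apply/orP; left; rewrite fin_num_measure//; exact: mUF.
apply: cvge_ge cvF; apply: nearW => n.
apply: le_trans (PF (maxn n M0) (leq_maxr _ _)) _.
apply: le_measure; rewrite ?inE//.
by move=> w Fw; exists (maxn n M0) => //=; exact: leq_maxl.
Qed.

(** * Independence across the coordinates *)

(** Any [K] indices of the infinite set [Q] all fail with probability [q ^+ K], where [q < 1]; let
    [K] tend to infinity. *)
Lemma indep_ae_exists (R : realType) (d : measure_display)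
    (T : measurableType d) (P : probability T R) (Z : nat -> R -> T -> R)
    (D : set (R -> R)) (Q : set nat) :
  (forall n t, 0 <= t -> measurable_fun setT (Z n t)) ->
  mutually_independent P (fun n => sigma_process (Z n)) ->
  (forall m n, same_law P (Z m) (Z n)) ->
  path_measurable D ->
  (0 < P (trajectory (Z 0%N) @^-1` D))%E ->
  (forall N, exists2 n, (N <= n)%N & Q n) ->
  {ae P, forall w, exists2 n, Q n & D (trajectory (Z n) w)}.
Proof.
move=> mZ indep law mD PD Qinf.
have mDc : path_measurable (~` D).
  exact: (@measurableC _ (path_space R) D).
have mE n (C : set (R -> R)) : path_measurable C ->
    measurable (trajectory (Z n) @^-1` C).
  move=> mC; rewrite -[X in measurable X]setTI.
  exact: (measurable_trajectory (mZ n)).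
pose q := 1 - fine (P (trajectory (Z 0%N) @^-1` D)).
have PDfin : P (trajectory (Z 0%N) @^-1` D) \is a fin_num.
  by rewrite fin_num_measure//; exact: mE.
have PDc n : P (trajectory (Z n) @^-1` (~` D)) = q%:E.
  rewrite (law n 0%N)// preimage_setC probability_setC; last exact: mE.
  by rewrite /q EFinB fineK.
have q1 : q < 1 by rewrite /q ltrBlDr ltrDl fine_gt0// PD ltey_eq PDfin.
have q0 : 0 <= q by rewrite -lee_fin -(PDc 0%N) measure_ge0.
pose F := \bigcap_(n in Q) (trajectory (Z n) @^-1` (~` D)).
have mF : measurable F.
  apply: bigcap_measurable => [|n _]; last exact: mE.
  by have [n _ Qn] := Qinf 0%N; exists n.
have PF K : (P F <= (q ^+ K)%:E)%E.
  have [s [us ss sQ]] : exists s : seq nat,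
      [/\ uniq s, size s = K & forall n, n \in s -> Q n].
    (* The bound [N] on the indices already chosen makes the next one fresh. *)
    suff [s [N [? ? ? _]]] : exists (s : seq nat) (N : nat),
      [/\ uniq s, size s = K, forall n, n \in s -> Q n
        & forall n, n \in s -> (n < N)%N] by exists s.
    elim: K => [|K [s [N [us ss sQ sN]]]]; first by exists [::], 0%N.
    have [n Nn Qn] := Qinf N.
    exists (n :: s), n.+1; split.
    - by rewrite /= us andbT; apply/negP => /sN; rewrite ltnNge Nn.
    - by rewrite /= ss.
    - by move=> m; rewrite inE => /predU1P[->//|/sQ].
    - by move=> m; rewrite inE => /predU1P[->//|/sN mN]; lia.
  have := indep s (fun n => trajectory (Z n) @^-1` (~` D)) us.
  rewrite (eq_bigr (fun=> q%:E)) => [|n _]; last exact: PDc.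
  rewrite prodEFin big_const_seq count_predT ss iter_mulr_1 => <-.
    apply: le_measure; rewrite ?inE//.
      by apply: bigcap_measurableType => n _; exact: mE.
    by move=> w Fw n /= /sQ; exact: Fw.
  by move=> n _; exists (~` D) => //; rewrite setTI.
have PF0 : P F = 0%E.
  apply/eqP; rewrite eq_le measure_ge0 andbT.
  have cq : (q ^+ K)%:E @[K --> \oo] --> 0%E.
    by apply: cvg_EFin; [exact: nearW|apply: cvg_expr; rewrite ger0_norm].
  by apply: cvge_ge cq; exact: nearW.
exists F; split => // w /= nex n Qn Dw; apply: nex; by exists n.
Qed.

(** * Oscillation of a fixed path *)

(** Absolute continuity of the integral, for [g] extended by 0 outside [[0, v]]. *)
Lemma Rintegral0_uniform_continuous (R : realType) (g : R -> R) (v eps : R) :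
  (@lebesgue_measure R).-integrable `[0, v] (EFin \o g) -> 0 < eps ->
  exists2 delta : R, 0 < delta & forall s s', 0 <= s -> s <= s' -> s' <= v ->
    s' - s < delta ->
    `|\int[lebesgue_measure]_(t in `[0, s']) g t -
      \int[lebesgue_measure]_(t in `[0, s]) g t| < eps.
Proof.
move=> intg eps0.
have : lebesgue_measure.-integrable setT (EFin \o (g \_ `[0, v])).
  by rewrite -restrict_EFin; apply/integrable_restrict => //=; rewrite setTI.
move=> /integral_normr_continuous /(_ _ eps0)[d [d0 dP]].
exists d => // s s' s0 ss' s'v s'sd.
have sub0 : `[0, s'] `<=` `[0, v] by apply: subset_itvl; rewrite bnd_simp.
have sub : `]s, s'] `<=` `[0, v].
  by move=> t /=; rewrite !in_itv/= => /andP[? ?]; apply/andP; split; lra.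
rewrite Rintegral_itvB ?bnd_simp//; last first.
  exact: integrableS intg.
have int1 : lebesgue_measure.-integrable `]s, s'] (EFin \o g).
  exact: integrableS intg.
apply: le_lt_trans (le_normr_Rintegral _ int1) _ => //.
have : (lebesgue_measure `]s, s']%classic < d%:E)%E.
  rewrite lebesgue_measure_itv/= lte_fin.
  by case: ifPn => // _; rewrite -EFinD lte_fin.
move=> /(dP _ (measurable_itv _)); apply: le_lt_trans.
rewrite le_eqVlt; apply/orP; left; apply/eqP.
apply: eq_Rintegral => t; rewrite inE => tss'.
by rewrite patchE mem_set//; exact: sub.
Qed.

(** Across a short cell where [f n] moves by more than [a], the noise term moves by at least [c * a]
    and the integral by less than [c * a / 2]; the norm dominates the coordinate. *)
Lemma rough_noise_oscillation (R : realType) (H : completeNormedModType R)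
    (ip : {dot H for idfun}) (e : nat -> H) (x : R -> H)
    (beta : nat -> R) (f g : nat -> R -> R) (a c u v : R) :
  induces_norm ip -> (forall n, ip (e n) (e n) = 1) ->
  (forall n t, 0 <= t ->
    (@lebesgue_measure R).-integrable `[0, t] (EFin \o g n)) ->
  (forall n i M, ip (x (i%:R / M%:R)) (e n) =
    \int[lebesgue_measure]_(s in `[0, i%:R / M%:R]) g n s +
    beta n * f n (i%:R / M%:R)) ->
  0 < a -> 0 < c ->
  (forall k i, exists2 n, c <= beta n & rough a k i (f n)) ->
  0 <= u -> u < v ->
  exists s s', [/\ u < s < v, u < s' < v & c * a / 2 <= `|x s - x s'|].
Proof.
move=> ipN e1 intg weak a0 c0 frough u0 uv.
(* Blocks shorter than [(v - u) / 2]: the one starting at the first multiple of [1 / (k + 1)] beyond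
   [u] ends before [v]. *)
pose k := Num.trunc (2 / (v - u)).
have K0 : 0 < k.+1%:R :> R by [].
have Kuv : 2 < (v - u) * k.+1%:R.
  by rewrite mulrC -ltr_pdivrMr ?subr_gt0//; exact: truncnS_gt.
pose i := (Num.trunc (u * k.+1%:R)).+1.
have /andP[i1 i2] := truncn_itv (mulr_ge0 u0 (ltW K0)).
have ui : u < i%:R / k.+1%:R by rewrite ltr_pdivlMr.
have iv : i.+1%:R / k.+1%:R < v.
  by rewrite ltr_pdivrMr// /i -addn2 natrD; move: Kuv; rewrite mulrBl => ?; lra.
have [n cn fn] := frough k i.
have v0 : 0 <= v by lra.
have [d d0 dP] := Rintegral0_uniform_continuous (intg n v v0)
  (divr_gt0 (mulr_gt0 c0 a0) (ltr0Sn _ 1)).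
(* The modulus [d] depends on [n]; since [f n] has large increments on infinitely many grids, one of
   mesh below [d] is available. *)
have [m /= dm [j /= /andP[ij ji]]] := fn (Num.trunc d^-1) I.
rewrite /cell_jump/=; set M := (k.+1 * m.+1)%N => aj.
have M0 : 0 < M%:R :> R by rewrite ltr0n.
have MK : M%:R = k.+1%:R * m.+1%:R :> R by rewrite natrM.
have is_ : i%:R / k.+1%:R <= j%:R / M%:R :> R.
  rewrite ler_pdivrMr// mulrAC ler_pdivlMr// MK (mulrC k.+1%:R) mulrA.
  by rewrite ler_wpM2r ?ler0n// -natrM ler_nat.
have si : j.+1%:R / M%:R <= i.+1%:R / k.+1%:R :> R.
  rewrite ler_pdivrMr// mulrAC ler_pdivlMr// MK (mulrC k.+1%:R) mulrA.
  by rewrite ler_wpM2r ?ler0n// -natrM ler_nat mulSn addnC.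
have step : j.+1%:R / M%:R = j%:R / M%:R + M%:R^-1 :> R.
  by rewrite -natr1 mulrDl mul1r.
have Md : M%:R^-1 < d.
  rewrite invf_plt ?posrE// (lt_le_trans (truncnS_gt _))// ler_nat.
  by apply: (@leq_trans m.+1) => //; exact: leq_pmull.
have Mi0 : 0 < M%:R^-1 :> R by rewrite invr_gt0.
exists (j.+1%:R / M%:R), (j%:R / M%:R).
have := weak n j M; have := weak n j.+1 M.
move: step aj is_ si; set s' := j.+1%:R / M%:R; set s := j%:R / M%:R.
move=> step aj is_ si ws' ws.
have us : u < s := lt_le_trans ui is_.
have sv : s' < v := le_lt_trans si iv.
have ss' : s < s' by rewrite step ltrDl.
have s0 : 0 <= s by rewrite (le_trans u0)// ltW.
have ssd : s' - s < d by rewrite step addrAC subrr add0r.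
rewrite us sv (lt_trans us ss') (lt_trans ss' sv); split => //.
have := dot_le_norm (x s' - x s) ipN (e1 n).
apply: le_trans.
rewrite linearBl/= ws' ws.
have Id : `|\int[lebesgue_measure]_(t in `[0, s']) g n t -
      \int[lebesgue_measure]_(t in `[0, s]) g n t| < c * a / 2.
  by apply: dP => //; exact: ltW.
set I' := Rintegral _ _ _ in Id *; set I := Rintegral _ _ _ in Id *.
have bf : c * a <= `|beta n * (f n s' - f n s)|.
  rewrite normrM; apply: ler_pM; [lra|lra| |exact: ltW].
  by apply: le_trans cn _; exact: ler_norm.
have -> : I' + beta n * f n s' - (I + beta n * f n s) =
  beta n * (f n s' - f n s) - (I - I') by ring.
have := lerB_dist (beta n * (f n s' - f n s)) (I - I').
rewrite (distrC I) => ?; lra.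
Qed.

(** * Absence of one-sided limits *)

Theorem theorem2p1 (R : realType)
  (d : measure_display) (T : measurableType d) (P : probability T R)
  (H : completeNormedModType R) (ip : {dot H for idfun})
  (e : nat -> H) (S : R -> H -> H) (A As : partial_operator H)
  (U : completeNormedModType R) (ipU : {dot U for idfun})
  (j : {linear H -> U})
  (beta : nat -> R) (Ln : nat -> R -> T -> R) (nu : {measure set R -> \bar R})
  (L : R -> T -> U) (X : R -> T -> H)
  (H_hilbert : induces_norm ip) (H_separable : separable_space H)
  (e_basis : orthonormal_basis ip e)
  (S_semigroup : C0_semigroup S) (A_generator : is_generator S A)
  (As_adjoint : is_adjoint ip A As)
  (U_hilbert : induces_norm ipU)
  (j_injective : injective j) (j_continuous : continuous j)
  (beta_gt0 : forall n, 0 < beta n)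
  (Ln_Levy : forall n, cadlag_Levy_process P (Ln n))
  (Ln_independent : mutually_independent P (fun n => sigma_process (Ln n)))
  (Ln_identical : forall m n, same_law P (Ln m) (Ln n))
  (Ln_nu : forall n, is_Levy_measure P (Ln n) nu)
  (nu_neq0 : exists2 B : set R, measurable B & nu B != 0%E)
  (L_sum : is_cylindrical_sum P j beta e Ln L)
  (X_convolution : is_stochastic_convolution P j S beta e Ln X)
  (X_weak_solution : weak_solution P ip As beta e Ln X)
  (e_dom : forall n, op_dom As (e n)) :
  ~ (beta @ \oo --> 0) ->
  {ae P, forall w, ~ exists t : R, 0 <= t /\
    ((0 < t /\ exists l : H, X s w @[s --> t^'-] --> l) \/
     (exists l : H, X s w @[s --> t^'+] --> l))}.
Proof.
move=> beta_ncvg.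
have [c c0 cinf] : exists2 c, 0 < c &
    forall N, exists2 n, (N <= n)%N & c <= beta n.
  apply: contrapT => nc; apply: beta_ncvg; apply/cvgrPdist_lt => c c0.
  have [N hN] : exists N, forall n, (N <= n)%N -> beta n < c.
    apply: contrapT => nN; apply: nc; exists c => // N.
    apply: contrapT => nn; apply: nN; exists N => n Nn.
    by rewrite ltNge; apply/negP => cn; apply: nn; exists n.
  by exists N => // n /= /hN; rewrite sub0r normrN gtr0_norm.
have mLn n t : 0 <= t -> measurable_fun setT (Ln n t).
  by have [+ _ _ _ _] := Ln_Levy n; exact.
have [a a0 Prough] := levy_rough_gt0 (Ln_Levy 0%N) (Ln_nu 0%N) nu_neq0.
have aerough : {ae P, forall w, forall k i,
    exists2 n, c <= beta n & rough a k i (trajectory (Ln n) w)}.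
  apply/ae_foralln => k; apply/ae_foralln => i.
  apply: (@indep_ae_exists _ _ _ _ _ _ [set n | c <= beta n]) => //.
  exact: measurable_rough.
have [_ /ae_foralln aeint weak] := X_weak_solution.
(* Only countably many times occur, so one null set serves them all; [M = 0] merely gives time 0. *)
have aeweak : {ae P, forall w, forall n i M, ip (X (i%:R / M%:R) w) (e n) =
    \int[lebesgue_measure]_(s in `[0, i%:R / M%:R]) ip (X s w) (As (e n)) +
    beta n * Ln n (i%:R / M%:R) w}.
  apply/ae_foralln => n; apply/ae_foralln => i; apply/ae_foralln => M.
  by apply: weak; rewrite divr_ge0.
apply: filterS3 aerough aeint aeweak => w roughw intw weakw [t [t0 lim]].
have osc u v : 0 <= u -> u < v -> exists s s',
    [/\ u < s < v, u < s' < v & c * a / 2 <= `|X s w - X s' w|].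
  have en n : ip (e n) (e n) = 1 by rewrite e_basis.1 eqxx.
  exact: (@rough_noise_oscillation _ _ ip e (X ^~ w) beta
    (fun n => trajectory (Ln n) w) (fun n s => ip (X s w) (As (e n))) a c).
(* Two values within [c * a / 4] of a limit would be closer to each other than the oscillation
   allows. *)
have ca0 : 0 < c * a / 4 by rewrite divr_gt0// mulr_gt0.
have close (l : H) s s' : `|l - X s w| < c * a / 4 ->
    `|l - X s' w| < c * a / 4 -> `|X s w - X s' w| < c * a / 2.
  move=> h h'; have := ler_distD l (X s w) (X s' w).
  by rewrite (distrC _ l); lra.
case: lim => [[{}t0 [l Xl]]|[l Xl]];
  have /cvgrPdist_lt /(_ _ ca0) [r /= r0 rP] := Xl.
(* The oscillation holds only at nonnegative times, hence the truncation at 0. *)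
- have max_ge0 : 0 <= Num.max 0 (t - r) by rewrite le_max lexx.
  have max_lt : Num.max 0 (t - r) < t by rewrite gt_max t0/=; lra.
  have [s [s' [/andP[s1 s2] /andP[s3 s4]]]] := osc _ _ max_ge0 max_lt.
  move: s1 s3; rewrite !gt_max => /andP[_ s1] /andP[_ s3].
  rewrite leNgt => /negP; apply; apply: (close l); apply: rP => //;
    by rewrite /ball/= gtr0_norm; lra.
- have ttr : t < t + r by rewrite ltrDl.
  have [s [s' [/andP[s1 s2] /andP[s3 s4]]]] := osc _ _ t0 ttr.
  rewrite leNgt => /negP; apply; apply: (close l); apply: rP => //;
    by rewrite /ball/= ltr0_norm; lra.
Qed.
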